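(* Let $P$ be a finite set of distinct points and $L$ a finite set of distinct non-vertical Legendrian lines in $\mathbb{R}^3$. Then $$ I(P,L) = O\left(|P|^{1/2}|L|^{3/4}+|P|+|L|\right). $$
   Context: A line in $\mathbb{R}^3$ is called Legendrian if at each of its points $(x,y,z)$ its direction vector is orthogonal to the vector $(y,-x,1)$. A line is vertical if it is parallel to the $z$-axis. $I(P,L)$ denotes the number of pairs $(p,\ell)\in P\times L$ with $p\in\ell$. *)

(* Defs.v *)
From HB Require Import structures.
From mathcomp Require Import all_boot all_order all_algebra finmap.
From mathcomp Require Import all_classical all_reals all_analysis.
Set Implicit Arguments.
Unset Strict Implicit.
Unset Printing Implicit Defensive.
Import Order.TTheory GRing.Theory Num.Theory.
Local Open Scope classical_set_scope.
Local Open Scope ring_scope.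

Definition orthogonal3 (R : realType) (u v : 'rV[R]_3) : Prop :=
  \sum_(i < 3) u 0 i * v 0 i = 0.

(* The coordinates x, y, z are the entries 0, 1, 2. *)
Definition contact_normal (R : realType) (p : 'rV[R]_3) : 'rV[R]_3 :=
  \row_(j < 3) [:: p 0 1; - p 0 0; 1]`_j.

Definition z_axis_vector (R : realType) : 'rV[R]_3 :=
  \row_(j < 3) [:: 0; 0; 1]`_j.

Definition line_through (R : realType) (a v : 'rV[R]_3) : set 'rV[R]_3 :=
  [set a + t *: v | t in [set: R]].

Definition direction_vector (R : realType) (l : set 'rV[R]_3) (v : 'rV[R]_3)
    : Prop :=
  v != 0 /\ exists a, l = line_through a v.

Definition is_line (R : realType) (l : set 'rV[R]_3) : Prop :=
  exists v, direction_vector l v.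

Definition legendrian_line (R : realType) (l : set 'rV[R]_3) : Prop :=
  is_line l /\
  forall v p, direction_vector l v -> l p -> orthogonal3 v (contact_normal p).

Definition vertical (R : realType) (l : set 'rV[R]_3) : Prop :=
  direction_vector l (z_axis_vector R).

Definition incidences (R : realType) (P : {fset 'rV[R]_3})
    (L : {fset (set 'rV[R]_3)}) : nat :=
  #|` [fset pl in (P `*` L)%fset | `[< pl.2 pl.1 >] ]%fset |.

(* Main.v *)
Require Import Defs.
From mathcomp Require Import all_boot all_order all_algebra.
From mathcomp Require Import perm ring lra zify boolp.
Set Implicit Arguments.
Unset Strict Implicit.
Unset Printing Implicit Defensive.
Import Order.TTheory GRing.Theory Num.Theory.
Local Open Scope ring_scope.

(**
The proof is by polynomial partitioning, with an elementary substitute for the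
Borsuk-Ulam theorem.  Given finite sets S_1, ..., S_N and a space of functions
of dimension N + 1, pick s_i in S_i uniformly at random and let f be the
function x |-> det (s_1, ..., s_N, x), which vanishes at all the s_i.  For a, b
in S_i the values f(b) for s_i = a and f(a) for s_i = b are opposite, so that
each S_i becomes a tournament once the other s_j are fixed; hence f separates
two random points of S_i with probability at least 1/3.  Iterating over the
cells that are still too large yields polynomials of total degree O(2^K) whose
sign vectors cut P into cells of at most |P| / 8^K points.

A line not contained in the zero set Z of their product meets O(2^K) cells, and
two points determine a line, so such lines contribute at most
O(2^K |L|) + |P|^2 / 8^K incidences.  For Legendrian lines inside Z = Z(f), let
Xf and Yf be the derivatives of f along the contact plane.  Both vanish at a
point on two such lines, and both have smaller degree than f when z is given
weight 2; induction on the degree bounds these incidences by |P| + O(2^K |L|).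
Finally 2^K is chosen of order |P|^(1/2) / |L|^(1/4).
*)

(** * Signs at an infinitesimal positive argument *)

Section LowestCoefficient.
Variable R : realFieldType.
Implicit Type p : {poly R}.

(** Its sign is that of [p] at small positive arguments, and it is 0 for [p = 0]; thus ['X] acts as
    an infinitesimal. *)
Definition low_coef p : R := p`_(find (fun c => c != 0) p).

Lemma low_coefE p k : (forall i, (i < k)%N -> p`_i = 0) -> p`_k != 0 ->
  low_coef p = p`_k.
Proof.
move=> p0 pk; rewrite /low_coef; congr (_`_ _).
have szk : (k < size p)%N by rewrite ltnNge; apply: contra pk => /(nth_default 0) ->.
have hp : has (fun c => c != 0) p by apply/(has_nthP 0); exists k.
apply/eqP; rewrite eqn_leq; apply/andP; split; rewrite leqNgt; apply/negP => lt.
  by have := before_find 0 lt; rewrite pk.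
by have := nth_find 0 hp; rewrite p0 // eqxx.
Qed.

Lemma low_coefN p : low_coef (- p) = - low_coef p.
Proof.
have [->|p0] := eqVneq p 0; first by rewrite oppr0 /low_coef !coef0 oppr0.
have ex : exists k, p`_k != 0 by exists (size p).-1; rewrite -lead_coefE lead_coef_eq0.
case: (ex_minnP ex) => k pk km.
have below i : (i < k)%N -> p`_i = 0.
  by move=> lt; apply/eqP/negPn/negP => /km; rewrite leqNgt lt.
rewrite (low_coefE below pk) (@low_coefE _ k) ?coefN ?oppr_eq0 //.
by move=> i lt; rewrite coefN below ?oppr0.
Qed.

End LowestCoefficient.

(** * A weak ham-sandwich theorem by averaging over transversals *)

Section HamSandwich.
Variables (R : realFieldType) (T : finType) (N : nat).
Variables (S : 'I_N -> {set T}) (phi : T -> 'I_N.+1 -> R).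
Hypothesis S_neq0 : forall i, S i != set0.

Local Notation transversal := {ffun 'I_N -> T}.
Implicit Types (s : transversal) (b c : T) (i : 'I_N).

(* The perturbation by ['X] makes every transversal independent. *)
Definition pvec i b (j : 'I_N.+1) : {poly R} :=
  (phi b j)%:P + 'X *+ (j == lift ord_max i).

Definition pmx s i b : 'M[{poly R}]_N.+1 :=
  \matrix_(r, j) if unlift ord_max r is Some k then pvec k (s k) j
                 else pvec i b j.

Definition pdet s i b := \det (pmx s i b).

Definition set_at s i b : transversal := [ffun k => if k == i then b else s k].

Lemma set_at_set s i b c : set_at (set_at s i b) i c = set_at s i c.
Proof. by apply/ffunP => k; rewrite !ffunE; case: eqP. Qed.

Lemma set_at_id s i : set_at s i (s i) = s.
Proof. by apply/ffunP => k; rewrite !ffunE; case: eqP => // ->. Qed.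

Lemma set_at_eq s i b : set_at s i b i = b.
Proof. by rewrite ffunE eqxx. Qed.

(** The last row carries the perturbation of index [i], so trading [b] for [s i] exchanges two
    rows. *)
Lemma pdet_swap s i b : pdet (set_at s i b) i (s i) = - pdet s i b.
Proof.
have -> : pdet (set_at s i b) i (s i)
          = \det (xrow (lift ord_max i) ord_max (pmx s i b)).
  congr (\det _); apply/matrixP => r j; rewrite !mxE.
  case: unliftP => [k ->|->]; last by rewrite tpermR liftK.
  rewrite ffunE; case: eqP => [->|/eqP ki]; first by rewrite tpermL unlift_none.
  rewrite tpermD ?liftK //; last by rewrite neq_lift.
  by rewrite (inj_eq lift_inj) eq_sym.
rewrite xrowE det_mulmx det_perm odd_tperm eq_sym neq_lift /=.
by rewrite expr1 mulN1r.
Qed.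

(** The cofactors of the last row depend on neither [i] nor [b], so one linear form serves all the
    sets. *)
Definition pcof s (j : 'I_N.+1) : {poly R} :=
  (-1) ^+ (N + j) * \det (\matrix_(r, k) pvec r (s r) (lift j k)).

Lemma pdetE s i b : pdet s i b = \sum_j pvec i b j * pcof s j.
Proof.
rewrite /pdet (expand_det_row _ ord_max); apply: eq_bigr => j _.
rewrite !mxE unlift_none; congr (_ * (_ * \det _)).
by apply/matrixP => r k; rewrite !mxE liftK.
Qed.

(** Without the last column the perturbation sits exactly on the diagonal, and the minor is a
    characteristic polynomial. *)
Lemma pcof_neq0 s : pcof s ord_max != 0.
Proof.
rewrite /pcof mulf_neq0 ?signr_eq0 //.
set M := (\matrix_(r, k) _).
suff -> : M = char_poly_mx (- \matrix_(r, k) phi (s r) (lift ord_max k)).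
  exact: monic_neq0 (char_poly_monic _).
apply/matrixP => r k; rewrite !mxE polyCN opprK addrC /pvec.
by rewrite (inj_eq lift_inj) eq_sym.
Qed.

(** The form [a] collects the coefficients of the cofactors at the least degree [k] where one of
    them is nonzero. The ['X] in the last row shifts degrees up and so adds nothing at degree
    [k]. *)
Lemma cofactor_form s : exists2 a : 'I_N.+1 -> R, (exists j, a j != 0) &
  forall i b, \sum_j a j * phi b j != 0 ->
    low_coef (pdet s i b) = \sum_j a j * phi b j.
Proof.
have ex : exists k, [exists j, (pcof s j)`_k != 0].
  exists (size (pcof s ord_max)).-1; apply/existsP; exists ord_max.
  by rewrite -lead_coefE lead_coef_eq0 pcof_neq0.
case: (ex_minnP ex) => k /existsP[j0 pk] km.
have below j l : (l < k)%N -> (pcof s j)`_l = 0.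
  move=> lt; apply/eqP/negPn/negP => h.
  have : [exists j, (pcof s j)`_l != 0] by apply/existsP; exists j.
  by move=> /km; rewrite leqNgt lt.
exists (fun j => (pcof s j)`_k); first by exists j0.
have coefk i b l : (l <= k)%N ->
    (pdet s i b)`_l = \sum_j (pcof s j)`_l * phi b j.
  move=> lk; rewrite pdetE coef_sum; apply: eq_bigr => j _.
  rewrite mulrDl coefD coefCM -[RHS]addr0; congr (_ + _); first exact: mulrC.
  rewrite mulrnAl coefMn coefXM.
  by case: l lk => [|l] lk; rewrite ?mul0rn //= below ?mul0rn.
move=> i b nz; rewrite (@low_coefE _ _ k) ?coefk // => l lt.
by rewrite coefk 1?ltnW // big1 // => j _; rewrite below // mul0r.
Qed.

Let X := [set s : transversal | [forall i, s i \in S i]].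

Let same s i b c : nat :=
  nat_of_bool (0 < low_coef (pdet s i b) * low_coef (pdet s i c)).

(* Of three points of a tournament, at most two fail to separate the others. *)
Lemma same_triple s i b c :
  (same s i b c + same (set_at s i b) i (s i) c
     + same (set_at s i c) i b (s i) <= 2)%N.
Proof.
rewrite /same !pdet_swap !low_coefN.
have -> : pdet (set_at s i c) i b = - pdet (set_at s i b) i c.
  by rewrite -pdet_swap set_at_set set_at_eq.
rewrite low_coefN.
move: (low_coef _) (low_coef (pdet s i c)) (low_coef (pdet s i b)) => w y x.
case: (ltP 0 (x * y)) => xy; case: (ltP 0 (- x * w)) => xw;
  case: (ltP 0 (- w * - y)) => wy //.
(* If all three products were positive, so would be their product, which is minus a square. *)
have := mulr_gt0 (mulr_gt0 xy xw) wy.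
suff -> : x * y * (- x * w) * (- w * - y) = - (x * y * w) ^+ 2.
  by rewrite oppr_gt0 ltNge sqr_ge0.
ring.
Qed.

Lemma set_atX s i b : s \in X -> b \in S i -> set_at s i b \in X.
Proof.
rewrite !inE => /forallP sX bS; apply/forallP => k; rewrite ffunE.
by case: eqP => // ->.
Qed.

(** Exchanging [s i] with [b], or with [c], is an involution on the triples [(s, (b, c))], so the
    three terms of [same_triple] have equal sums. *)
Lemma mean_same i :
  (3 * \sum_(s in X) \sum_(b in S i) \sum_(c in S i) same s i b c
     <= 2 * \sum_(s in X) #|S i| ^ 2)%N.
Proof.
pose Q := [set x : transversal * (T * T) |
            [&& x.1 \in X, x.2.1 \in S i & x.2.2 \in S i]].
pose F (x : transversal * (T * T)) := same x.1 i x.2.1 x.2.2.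
have flat (G : transversal * (T * T) -> nat) :
    (\sum_(s in X) \sum_(b in S i) \sum_(c in S i) G (s, (b, c))
       = \sum_(x in Q) G x)%N.
  under eq_bigr do rewrite pair_big /=.
  rewrite pair_big /=; apply: eq_big => [[s [b c]]|[s [b c]] _] //=.
  by rewrite !inE.
pose t1 (x : transversal * (T * T)) :=
  (set_at x.1 i x.2.1, (x.1 i, x.2.2)).
pose t2 (x : transversal * (T * T)) :=
  (set_at x.1 i x.2.2, (x.2.1, x.1 i)).
have t1K : involutive t1.
  by case=> s [b c]; rewrite /t1 /= set_at_set set_at_eq set_at_id.
have t2K : involutive t2.
  by case=> s [b c]; rewrite /t2 /= set_at_set set_at_eq set_at_id.
have XS s : s \in X -> s i \in S i by rewrite inE => /forallP.
have inQ s b c : ((s, (b, c)) \in Q) = [&& s \in X, b \in S i & c \in S i].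
  by rewrite in_set.
have t1Q x : x \in Q -> t1 x \in Q.
  case: x => s [b c]; rewrite /t1 /= !inQ => /and3P[sX bS cS].
  by rewrite set_atX // XS.
have t2Q x : x \in Q -> t2 x \in Q.
  case: x => s [b c]; rewrite /t2 /= !inQ => /and3P[sX bS cS].
  by rewrite set_atX // XS // bS.
have reix t : involutive t -> (forall x, x \in Q -> t x \in Q) ->
    (\sum_(x in Q) F x = \sum_(x in Q) F (t x))%N.
  move=> tK tQ; rewrite (reindex_inj (inv_inj tK)); apply: eq_bigl => x.
  by apply/idP/idP => /tQ //; rewrite tK.
have -> : (\sum_(s in X) #|S i| ^ 2 = \sum_(x in Q) 1)%N.
  rewrite -(flat (fun=> 1%N)); apply: eq_bigr => s _.
  by under eq_bigr do rewrite sum1_card; rewrite sum_nat_const.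
rewrite (flat F); have -> : (3 * \sum_(x in Q) F x = \sum_(x in Q) F x
    + \sum_(x in Q) F (t1 x) + \sum_(x in Q) F (t2 x))%N.
  by rewrite -(reix _ t1K t1Q) -(reix _ t2K t2Q) mulSn mul2n -addnn addnA.
rewrite -!big_split big_distrr /=; apply: leq_sum => -[s [b c]] _.
by rewrite muln1; exact: same_triple.
Qed.

(** Some transversal does at least as well as the average in [mean_same], summed over [i]. Only
    strictly positive products are counted, so both values are nonzero and [cofactor_form]
    applies. *)
Lemma weak_ham_sandwich : exists2 a : 'I_N.+1 -> R, (exists j, a j != 0) &
  (3 * \sum_i \sum_(b in S i) \sum_(c in S i)
         (0 < (\sum_j a j * phi b j) * (\sum_j a j * phi c j))%R
     <= 2 * \sum_i #|S i| ^ 2)%N.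
Proof.
pose W s := (3 * \sum_i \sum_(b in S i) \sum_(c in S i) same s i b c)%N.
have [s sX Ws] : exists2 s, s \in X & (W s <= 2 * \sum_i #|S i| ^ 2)%N.
  have [s0 s0X] : exists s, s \in X.
    have pick i : {b | b \in S i} by apply/sigW/set0Pn.
    exists [ffun i => sval (pick i)]; rewrite inE; apply/forallP => i.
    by rewrite ffunE; case: (pick i).
  apply/exists_inP; apply: contraT => /exists_inPn big.
  have : (\sum_(s in X) W s <= \sum_(s in X) 2 * \sum_i #|S i| ^ 2)%N.
    rewrite -!big_distrr /= exchange_big [X in (_ <= 2 * X)%N]exchange_big /=.
    by rewrite !big_distrr /=; apply: leq_sum => i _; exact: mean_same.
  rewrite leqNgt => /negP[]; rewrite (bigD1 s0) //= [ltnRHS](bigD1 s0) //=.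
  rewrite -addSn leq_add //; first by rewrite ltnNge big.
  by apply: leq_sum => s /andP[sX _]; rewrite ltnW // ltnNge big.
have [a a0 aE] := cofactor_form s; exists a => //.
apply: leq_trans Ws; rewrite leq_mul2l /=.
apply: leq_sum => i _; apply: leq_sum => b _; apply: leq_sum => c _.
case: ltP => // bc; suff -> : same s i b c = 1%N by [].
have [b0 c0] : \sum_j a j * phi b j != 0 /\ \sum_j a j * phi c j != 0.
  by apply/andP; rewrite -negb_or -mulf_eq0 gt_eqF.
by rewrite /same !aE // bc.
Qed.

End HamSandwich.

(** * Polynomial functions of bounded weighted degree *)

Section WeightedPolynomials.
Variable R : rcfType.
Implicit Types (p v : 'rV[R]_3) (f g h : 'rV[R]_3 -> R) (q : {poly R}).

Definition monomial3 (i j k : nat) p : R := p 0 0 ^+ i * p 0 1 ^+ j * p 0 2 ^+ k.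

(* The coordinate z has weight 2, as in the Heisenberg group: this is the
   grading lowered by the horizontal derivatives. *)
Inductive wpoly (d : nat) : ('rV[R]_3 -> R) -> Prop :=
| wpoly0 f of (forall p, f p = 0) : wpoly d f
| wpolyD c i j k f g of (i + j + 2 * k < d)%N & wpoly d f
    & (forall p, g p = c * monomial3 i j k p + f p) : wpoly d g.

(** The bound is conditional on [c != 0] because differentiation gives terms with factor [i%:R] and
    truncated exponent [i.-1], which vanish for [i = 0]. *)
Lemma wpolyD' d c i j k f : (c != 0 -> (i + j + 2 * k < d)%N) -> wpoly d f ->
  wpoly d (fun p => c * monomial3 i j k p + f p).
Proof.
have [-> _|c0 w] := eqVneq c 0; last by move=> fP; apply: wpolyD (w isT) fP _.
case=> [{}f f0|c' i' j' k' f' g w f'P gE].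
  by apply: wpoly0 => p; rewrite mul0r add0r.
by apply: wpolyD w f'P _ => p; rewrite mul0r add0r gE.
Qed.

Lemma wpoly_ext d f g : (forall p, g p = f p) -> wpoly d f -> wpoly d g.
Proof.
move=> fg fP; case: fP fg => [{}f f0 fg|c i j k f' {}f w f'P fE fg].
  by apply: wpoly0 => p; rewrite fg.
by apply: wpolyD w f'P _ => p; rewrite fg.
Qed.

Lemma wpoly_add d f g : wpoly d f -> wpoly d g -> wpoly d (fun p => f p + g p).
Proof.
elim=> [{}f f0|c i j k f' {}f w _ IH fE] gP.
  by apply: wpoly_ext gP => p; rewrite f0 add0r.
by apply: wpolyD w (IH gP) _ => p; rewrite fE addrA.
Qed.

Lemma wpoly_mul d e f g : wpoly d f -> wpoly e g ->
  wpoly (d + e) (fun p => f p * g p).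
Proof.
move=> fP gP.
have mulP c i j k : (i + j + 2 * k < d)%N ->
    wpoly (d + e) (fun p => c * monomial3 i j k p * g p).
  move=> w; elim: gP => [g' g0|c' i' j' k' g' g'' w' _ IH' gE].
    by apply: wpoly0 => p; rewrite g0 mulr0.
  apply: (@wpolyD _ (c * c') (i + i') (j + j') (k + k')) IH' _; first lia.
  by move=> p; rewrite gE /monomial3 !exprD; ring.
elim: fP => [f' f0|c i j k f' f'' w _ IH fE].
  by apply: wpoly0 => p; rewrite f0 mul0r.
by apply: wpoly_ext (wpoly_add (mulP c i j k w) IH) => p; rewrite fE; ring.
Qed.

Lemma size_affine_exp (a b : R) n : (size ((a%:P + b *: 'X) ^+ n)%R <= n.+1)%N.
Proof.
apply: leq_trans (size_poly_exp_leq _ _) _; rewrite ltnS.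
have : (size (a%:P + b *: 'X)%R <= 2)%N.
  rewrite (leq_trans (size_polyD _ _)) // geq_max.
  rewrite (leq_trans (size_polyC_leq1 _)) //=.
  by rewrite (leq_trans (size_scale_leq _ _)) // size_polyX.
by case: (size _) => [|[|[|]]] //= _; rewrite ?mul0n ?mul1n.
Qed.

(** Here [g] is f_x - y f_z and [h] is f_y + x f_z, and the last clause is the chain rule along a
    horizontal line. Differentiating in z lowers the weight by 2 and the factor x or y restores 1,
    hence [d.-1]. *)
Lemma wpoly_deriv d f : wpoly d f -> exists g h,
  [/\ wpoly d.-1 g, wpoly d.-1 h &
  forall p v, exists q, [/\ (size q <= d)%N,
    forall t, q.[t] = f (p + t *: v) &
    v 0 2 = v 0 1 * p 0 0 - v 0 0 * p 0 1 ->
    forall t, q^`().[t] = v 0 0 * g (p + t *: v) + v 0 1 * h (p + t *: v)]].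
Proof.
elim=> [{}f f0|c i j k f' {}f w _ [g [h [gP hP fq]]] fE].
  exists (fun=> 0), (fun=> 0); split; [exact: wpoly0|exact: wpoly0|move=> p v].
  exists 0; split=> [|t|_ t]; rewrite ?size_poly0 ?horner0 ?f0 //.
  by rewrite deriv0 horner0 !mulr0 addr0.
pose g1 p := c * i%:R * monomial3 i.-1 j k p
               + (- (c * k%:R) * monomial3 i j.+1 k.-1 p + g p).
pose h1 p := c * j%:R * monomial3 i j.-1 k p
               + (c * k%:R * monomial3 i.+1 j k.-1 p + h p).
have nz (n : nat) (a : R) : a * n%:R != 0 -> (0 < n)%N.
  by case: n => //; rewrite mulr0 eqxx.
exists g1, h1; split.
- apply: wpolyD' => [/nz|]; first lia.
  by apply: wpolyD' gP; rewrite oppr_eq0 => /nz; lia.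
- apply: wpolyD' => [/nz|]; first lia.
  by apply: wpolyD' hP => /nz; lia.
move=> p v; have [q [szq qE dq]] := fq p v.
pose A := (p 0 0)%:P + v 0 0 *: 'X; pose B := (p 0 1)%:P + v 0 1 *: 'X.
pose C := (p 0 2)%:P + v 0 2 *: 'X.
have AE t : A.[t] = (p + t *: v) 0 0 by rewrite !hornerE !mxE mulrC.
have BE t : B.[t] = (p + t *: v) 0 1 by rewrite !hornerE !mxE mulrC.
have CE t : C.[t] = (p + t *: v) 0 2 by rewrite !hornerE !mxE mulrC.
have szA := size_affine_exp (p 0 0) (v 0 0) i; rewrite -/A in szA.
have szB := size_affine_exp (p 0 1) (v 0 1) j; rewrite -/B in szB.
have szC := size_affine_exp (p 0 2) (v 0 2) k; rewrite -/C in szC.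
have dA : A^`() = (v 0 0)%:P by rewrite derivD derivC derivZ derivX add0r alg_polyC.
have dB : B^`() = (v 0 1)%:P by rewrite derivD derivC derivZ derivX add0r alg_polyC.
have dC : C^`() = (v 0 2)%:P by rewrite derivD derivC derivZ derivX add0r alg_polyC.
clearbody A B C.
exists (c *: (A ^+ i * B ^+ j * C ^+ k) + q); split.
- rewrite (leq_trans (size_polyD _ _)) // geq_max szq andbT.
  rewrite (leq_trans (size_scale_leq _ _)) //.
  have := size_polyMleq (A ^+ i * B ^+ j) (C ^+ k).
  have := size_polyMleq (A ^+ i) (B ^+ j).
  lia.
- by move=> t; rewrite hornerD hornerZ !hornerM !horner_exp AE BE CE qE fE.
move=> leg t; rewrite derivD derivZ !derivM !deriv_exp dA dB dC !hornerE dq //.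
rewrite !hornerMn !hornerE AE BE CE /g1 /h1 /monomial3.
(* Horizontality at [p] persists along the line: the increments in [t] cancel. *)
have -> : v 0 2 = v 0 1 * (p + t *: v) 0 0 - v 0 0 * (p + t *: v) 0 1.
  by rewrite leg !mxE; ring.
move: ((p + t *: v) 0 0) ((p + t *: v) 0 1) ((p + t *: v) 0 2) => x y z.
rewrite !exprS.
move: (x ^+ i) (x ^+ i.-1) (y ^+ j) (y ^+ j.-1) (z ^+ k) (z ^+ k.-1).
move: (g _) (h _) => G H X X' Y Y' Z Z'.
rewrite /=; ring.
Qed.

Lemma wpoly_line d f p v : wpoly d f ->
  exists2 q : {poly R}, (size q <= d)%N & forall t, q.[t] = f (p + t *: v).
Proof. by case/wpoly_deriv => g [h [_ _ /(_ p v)[q [? ? _]]]]; exists q. Qed.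

Lemma wpoly_deg0 f p : wpoly 0 f -> f p = 0.
Proof.
case=> [{}f f0|c i j k f' {}f w]; first exact: f0.
by rewrite ltn0 in w.
Qed.

Lemma poly_nonroot q : q != 0 -> exists t, q.[t] != 0.
Proof.
move=> q0; pose s := [seq i%:R : R | i <- iota 0 (size q)].
have : ~~ all (root q) s.
  apply/negP => qs; have := max_poly_roots q0 qs.
  rewrite map_inj_uniq ?iota_uniq; last by move=> i j /mulrIn -> //; exact: oner_neq0.
  by rewrite size_map size_iota ltnn => /(_ isT).
by case/allPn => t _ qt; exists t.
Qed.

(** On the line joining the two points both restrictions are nonzero polynomials in one variable,
    hence so is their product. *)
Lemma wpoly_mul_neq0 d e f g p p' : wpoly d f -> wpoly e g ->
  f p != 0 -> g p' != 0 -> exists p, f p * g p != 0.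
Proof.
move=> fP gP fp gp.
have [q1 _ q1E] := wpoly_line p (p' - p) fP.
have [q2 _ q2E] := wpoly_line p (p' - p) gP.
have q10 : q1 != 0.
  by apply: contraNneq fp => q0; rewrite -[p]addr0 -(scale0r (p' - p)) -q1E q0 horner0.
have q20 : q2 != 0.
  apply: contraNneq gp => q0; rewrite -[p'](subrKC p).
  by rewrite -[p' - p]scale1r -q2E q0 horner0.
have [t] := poly_nonroot (mulf_neq0 q10 q20).
by rewrite hornerM q1E q2E; exists (p + t *: (p' - p)).
Qed.

Lemma poly_roots_seq q : q != 0 ->
  exists2 s : seq R, (size s < size q)%N & forall t, root q t -> t \in s.
Proof.
have [n] := ubnP (size q); elim: n q => // n IH q szq q0.
have [[t rt]|nort] := pselect (exists t, root q t); last first.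
  exists [::]; first by rewrite size_poly_gt0.
  by move=> t rt; case: nort; exists t.
have /factor_theorem[q' qE] := rt.
have q'0 : q' != 0 by apply: contraNneq q0 => q'0; rewrite qE q'0 mul0r.
have szE : size q = (size q').+1.
  by rewrite qE size_Mmonic ?monicXsubC // size_XsubC addn2.
have [|s szs sP] := IH q' _ q'0; first by rewrite szE in szq.
exists (t :: s); first by rewrite szE.
by move=> u; rewrite qE rootM root_XsubC inE orbC => /orP[->|/sP ->]; rewrite ?orbT.
Qed.

End WeightedPolynomials.

(** * Independent monomials by Kronecker substitution *)

Section Kronecker.
Variables (R : rcfType) (n : nat).
Hypothesis n_gt0 : (0 < n)%N.

(** The exponents are the base-[n] digits of [m]; on the curve (t, t^n, t^(n^2)) this becomes t^m,
    so distinct indices are linearly independent. *)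
Definition digit_monomial (m : nat) : 'rV[R]_3 -> R :=
  monomial3 (m %% n) ((m %/ n) %% n) (m %/ n %/ n).

Lemma digit_monomial_curve (m : nat) (t : R) :
  digit_monomial m (\row_j [:: t; t ^+ n; t ^+ (n * n)]`_j) = t ^+ m.
Proof.
rewrite /digit_monomial /monomial3 !mxE /= -!exprM -!exprD; congr (_ ^+ _).
by rewrite [RHS](divn_eq m n) [X in (_ = X * _ + _)%N](divn_eq (m %/ n) n); ring.
Qed.

(** Indices below [n ^ 3] have three digits below [n], and the last one counts twice: hence
    [4 * n]. *)
Lemma wpoly_digit_sum N (a : 'I_N -> R) : (N <= n ^ 3)%N ->
  wpoly (4 * n) (fun p => \sum_j a j * digit_monomial j p).
Proof.
move=> Nn; elim: (index_enum _) => [|j r IH].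
  by apply: wpoly0 => p; rewrite big_nil.
apply: (@wpolyD R _ (a j) (j %% n) ((j %/ n) %% n) (j %/ n %/ n) _ _ _ IH);
  last by move=> p; rewrite big_cons.
have lt_j : (j < n * n * n)%N.
  by apply: leq_trans (ltn_ord j) _; rewrite mulnn -expnSr.
have := ltn_pmod j n_gt0; have := ltn_pmod (j %/ n) n_gt0.
have : (j %/ n %/ n < n)%N by rewrite !ltn_divLR.
lia.
Qed.

Lemma digit_sum_neq0 N (a : 'I_N -> R) : (exists j, a j != 0) ->
  exists p, \sum_j a j * digit_monomial j p != 0.
Proof.
case=> j0 aj0.
have [t] : exists t, (\sum_j a j *: 'X^j : {poly R}).[t] != 0.
  apply: poly_nonroot; apply: contraNneq aj0 => /(congr1 (fun q : {poly R} => q`_j0)).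
  rewrite coef0 coef_sum (bigD1 j0) //= big1 ?addr0; last first.
    by move=> j jj0; rewrite coefZ coefXn eq_sym (inj_eq val_inj) (negPf jj0) mulr0.
  by rewrite coefZ coefXn eqxx mulr1 => ->.
rewrite horner_sum; under eq_bigr do rewrite hornerZ hornerXn.
move=> nz; exists (\row_j [:: t; t ^+ n; t ^+ (n * n)]`_j).
by under eq_bigr do rewrite digit_monomial_curve.
Qed.

End Kronecker.

(** * Polynomial partitioning *)

Section PolynomialPartition.
Variables (R : rcfType) (T : finType) (pt : T -> 'rV[R]_3).
Implicit Types (f : 'rV[R]_3 -> R) (fs : seq ('rV[R]_3 -> R)) (p q : 'rV[R]_3).
Implicit Types (t u : T).

(** The index is to bound the product through [wpoly], whose bound is strict; the empty product is a
    nonzero constant, hence the initial 1. *)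
Inductive wfam : nat -> seq ('rV[R]_3 -> R) -> Prop :=
| wfam_nil : wfam 1 [::]
| wfam_cons d e f fs p of wpoly d f & f p != 0 & wfam e fs :
    wfam (d + e) (f :: fs).

Definition same_sign fs p q := all (fun f => 0 < f p * f q) fs.

Lemma same_sign_sym fs p q : same_sign fs p q = same_sign fs q p.
Proof. by apply: eq_all => f; rewrite mulrC. Qed.

Lemma same_sign_trans fs p q r :
  same_sign fs p q -> same_sign fs q r -> same_sign fs p r.
Proof.
elim: fs => //= f fs IH /andP[pq fpq] /andP[qr fqr]; rewrite IH // andbT.
have q0 : f q != 0 by apply: contraTneq qr => ->; rewrite mul0r ltxx.
have := mulr_gt0 pq qr.
have -> : f p * f q * (f q * f r) = f p * f r * f q ^+ 2 by ring.
by rewrite pmulr_lgt0 // exprn_even_gt0.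
Qed.

(** Empty if some member of [fs] vanishes at [pt t], because [same_sign] is strict. *)
Definition cell fs t := [set u | same_sign fs (pt t) (pt u)].

Lemma cell_refl fs t u : u \in cell fs t -> t \in cell fs t.
Proof.
rewrite !inE => tu; apply: (same_sign_trans tu).
by rewrite same_sign_sym.
Qed.

Lemma cell_eq fs t u : u \in cell fs t -> cell fs u = cell fs t.
Proof.
rewrite inE => tu; apply/setP => w; rewrite !inE; apply/idP/idP.
  exact: same_sign_trans.
by apply: same_sign_trans; rewrite same_sign_sym.
Qed.

Definition heavy A fs := [set t | #|T| < A * #|cell fs t|]%N.

(* The number of pairs of points sharing a heavy cell. *)
Definition potential A fs := (\sum_(t in heavy A fs) #|cell fs t|)%N.

Lemma heavy_refl A fs t : t \in heavy A fs -> t \in cell fs t.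
Proof.
rewrite inE => tA; have /set0Pn[u /cell_refl //] : cell fs t != set0.
by rewrite -card_gt0; case: #|_| tA; rewrite ?muln0.
Qed.

Lemma heavy_cell A fs t u : t \in heavy A fs -> u \in cell fs t ->
  u \in heavy A fs.
Proof. by move=> tA /cell_eq tu; move: tA; rewrite !inE tu. Qed.

Let Hs A fs := [set cell fs t | t in heavy A fs].

Lemma heavy_big A fs (F : T -> nat) :
  (\sum_(t in heavy A fs) F t = \sum_(S in Hs A fs) \sum_(t in S) F t)%N.
Proof.
rewrite (partition_big_imset (cell fs)) /=; apply: eq_bigr => S /imsetP[u uA ->].
apply: eq_bigl => t; apply/andP/idP => [[tA /eqP <-]|tu].
  exact: heavy_refl tA.
by rewrite (heavy_cell uA tu) (cell_eq tu).
Qed.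

Lemma potentialE A fs : potential A fs = (\sum_(S in Hs A fs) #|S| ^ 2)%N.
Proof.
rewrite /potential heavy_big; apply: eq_bigr => S /imsetP[u uA ->].
by under eq_bigr => t /cell_eq -> do []; rewrite sum_nat_const.
Qed.

(** A single heavy cell already contributes more than (|T| / A)^2; a smaller potential therefore
    leaves no heavy cell. *)
Lemma heavy_potential A fs t : t \in heavy A fs ->
  (#|T| ^ 2 < potential A fs * A ^ 2)%N.
Proof.
move=> tA; rewrite potentialE (bigD1 (cell fs t)) /=; last exact: imset_f.
rewrite mulnDl -expnMn mulnC ltn_addr // ltn_sqr.
by move: tA; rewrite inE.
Qed.

(** Each heavy cell contributes at least (|T| / A)^2 to the potential, so there are at most [8 ^ m];
    [weak_ham_sandwich] treats them all with one polynomial. *)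
Lemma partition_round A fs d m : wfam d fs ->
  (potential A fs * A ^ 2 <= 8 ^ m * #|T| ^ 2)%N ->
  exists2 f, wfam (8 * 2 ^ m + d) (f :: fs) &
    (3 * potential A (f :: fs) <= 2 * potential A fs)%N.
Proof.
move=> fsP potm; pose N := #|Hs A fs|; pose S (i : 'I_N) := enum_val i.
have SH i : S i \in Hs A fs by exact: enum_valP.
have Nm : (N <= 8 ^ m)%N.
  have [t _|H0] := pickP (mem (heavy A fs)); last first.
    rewrite /N (_ : Hs A fs = set0) ?cards0 //.
    by apply/setP => Z; rewrite inE; apply/imsetP => -[t]; rewrite [_ \in _]H0.
  have T0 : (0 < #|T| ^ 2)%N by rewrite expn_gt0; apply/orP; left; apply/card_gt0P; exists t.
  rewrite -(leq_pmul2r T0); apply: leq_trans potm.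
  rewrite potentialE big_distrl /= -sum_nat_const; apply: leq_sum => Z.
  by case/imsetP => u; rewrite inE => /ltnW uA ->; rewrite mulnC -expnMn leq_sqr.
(* Then [n ^ 3 = 8 * 8 ^ m] exceeds the number of heavy cells, and the degree bound [4 * n] is
   [8 * 2 ^ m]. *)
pose n := (2 ^ m.+1)%N; have n0 : (0 < n)%N by rewrite expn_gt0.
have Nn : (N.+1 <= n ^ 3)%N.
  by rewrite /n -expnM mulnC expnM (leq_ltn_trans Nm) // ltn_exp2l.
have S0 i : S i != set0.
  have /imsetP[t tA ->] := SH i.
  by apply/set0Pn; exists t; exact: heavy_refl tA.
have [a a0 aS] := weak_ham_sandwich
  (fun b (j : 'I_N.+1) => digit_monomial n j (pt b)) S0.
pose f p := \sum_j a j * digit_monomial n j p.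
have [p fp] := digit_sum_neq0 n a0.
exists f.
  rewrite (_ : 8 * 2 ^ m = 4 * n)%N; last by rewrite /n expnS; lia.
  exact: wfam_cons (wpoly_digit_sum n0 a Nn) fp fsP.
have sumS (F : {set T} -> nat) : (\sum_(Z in Hs A fs) F Z = \sum_i F (S i))%N.
  by rewrite big_enum_val.
rewrite (potentialE A fs) sumS; apply: leq_trans aS; rewrite leq_mul2l /=.
rewrite -(sumS (fun Z => \sum_(b in Z) \sum_(c in Z)
  (0 < f (pt b) * f (pt c))%R)%N).
(* Cells only shrink, so every newly heavy point was heavy before. *)
apply: (@leq_trans (\sum_(t in heavy A fs) #|cell (f :: fs) t|)%N).
  have sub : heavy A (f :: fs) \subset heavy A fs.
    apply/subsetP => t; rewrite !inE => /leq_trans; apply.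
    rewrite leq_mul2l subset_leq_card ?orbT //.
    by apply/subsetP => u; rewrite !inE => /andP[].
  rewrite /potential [leqRHS](big_setID (heavy A (f :: fs))) /=.
  by rewrite (setIidPr sub) leq_addr.
rewrite heavy_big; apply: leq_sum => Z /imsetP[u uA ->].
apply: leq_sum => t tu; rewrite -sum1_card big_mkcond [leqRHS]big_mkcond /=.
apply: leq_sum => w _; rewrite -(cell_eq tu) !inE /=.
by case: (0 < _); case: (same_sign _ _ _).
Qed.

Lemma partition_rounds r A fs d m : wfam d fs ->
  (potential A fs * A ^ 2 <= 8 ^ m * #|T| ^ 2)%N ->
  exists2 fs', wfam (r * (8 * 2 ^ m) + d) fs' &
    (3 ^ r * potential A fs' <= 2 ^ r * potential A fs)%N.
Proof.
move=> fsP potm; elim: r => [|r [fs' fs'P potr]]; first by exists fs.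
have le : (potential A fs' <= potential A fs)%N.
  rewrite -(@leq_pmul2l (3 ^ r)) ?expn_gt0 //; apply: leq_trans potr _.
  by rewrite leq_mul2r; case: (r) => [|r']; rewrite ?leqnn ?leq_exp2r ?orbT.
have [|f fP potf] := partition_round fs'P (m := m) (A := A).
  by apply: leq_trans potm; rewrite leq_mul2r le orbT.
exists (f :: fs'); first by rewrite mulSn -addnA.
rewrite !expnS; nia.
Qed.

(** Six rounds scale the potential by at most (2/3)^6 = 64/729 < 1/8 and so lower [m] by one; at
    [m = 0] no heavy cell survives. The costs [48 * 2 ^ m] form a geometric sum below
    [96 * 2 ^ m]. *)
Lemma partition_reduce m A fs d : wfam d fs ->
  (potential A fs * A ^ 2 <= 8 ^ m * #|T| ^ 2)%N ->
  exists d' fs', [/\ (d' <= 96 * 2 ^ m + d)%N, wfam d' fs' & heavy A fs' = set0].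
Proof.
elim: m fs d => [|m IH] fs d fsP potm;
  have [fs' fs'P pot'] := partition_rounds 6 fsP potm;
  have {}pot' : (729 * (potential A fs' * A ^ 2)
                   <= 64 * (potential A fs * A ^ 2))%N
    by rewrite [leqLHS]mulnA [leqRHS]mulnA leq_mul2r [X in _ || X]pot' orbT.
  exists (6 * (8 * 2 ^ 0) + d)%N, fs'; split=> //; first lia.
  apply/eqP; rewrite -subset0; apply/subsetP => t /heavy_potential.
  by rewrite mul1n in potm; lia.
have [|d' [fs'' [d'P fs''P H0]]] := IH fs' _ fs'P.
  by move: potm; rewrite (expnS 8 m) -mulnA; lia.
by exists d', fs''; split=> //; move: d'P; rewrite (expnS 2 m); lia.
Qed.

(** Cells of at most |T| / 8^K points bound the potential by |T|^2 / 8^K. For [A = 8 ^ K.+1] this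
    permits [m = K.+2], and the cost [96 * 2 ^ K.+2 = 384 * 2 ^ K] doubles the degree bound. *)
Lemma polynomial_partition K : exists d fs, [/\ (d <= 384 * 2 ^ K)%N, wfam d fs &
  forall t, (8 ^ K * #|cell fs t| <= #|T|)%N].
Proof.
elim: K => [|K [d [fs [dK fsP fsK]]]].
  exists 1%N, [::]; split=> // [|t]; first exact: wfam_nil.
  by rewrite mul1n max_card.
have [|d' [fs' [d'P fs'P H0]]] := @partition_reduce K.+2 (8 ^ K.+1) fs d fsP.
  have pot : (8 ^ K * potential (8 ^ K.+1) fs <= #|T| ^ 2)%N.
    rewrite /potential big_distrr /= -mulnn -sum_nat_const.
    apply: leq_trans (leq_sum _ (fun t _ => fsK t)) _.
    by rewrite !sum_nat_const leq_mul2r max_card orbT.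
  apply: leq_trans (leq_mul (leqnn (8 ^ K.+2)) pot).
  by rewrite !expnS; lia.
exists d', fs'; split=> //.
  by move: dK d'P; rewrite !expnS; lia.
move=> t; have : t \notin heavy (8 ^ K.+1) fs' by rewrite H0 inE.
by rewrite inE -leqNgt.
Qed.

End PolynomialPartition.

(** * Connectivity by horizontal segments *)

Section HorizontalConnectivity.
Variable R : rcfType.
Implicit Types (p q v : 'rV[R]_3) (f : 'rV[R]_3 -> R).

Lemma rV3P p q : p 0 0 = q 0 0 -> p 0 1 = q 0 1 -> p 0 2 = q 0 2 -> p = q.
Proof.
move=> e0 e1 e2; apply/rowP => -[[|[|[|//]]] lt].
- by rewrite (_ : Ordinal lt = 0) //; apply: val_inj.
- by rewrite (_ : Ordinal lt = 1) //; apply: val_inj.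
by rewrite (_ : Ordinal lt = 2) //; apply: val_inj.
Qed.

Definition mk3 (x y z : R) : 'rV[R]_3 := \row_j [:: x; y; z]`_j.

Definition horizontal p v := v 0 2 = v 0 1 * p 0 0 - v 0 0 * p 0 1.

(** A radial segment joins each point horizontally to the z-axis at the same height, and horizontal
    paths move along that axis. *)
Lemma horizontal_connected f :
    (forall p v t, horizontal p v -> f (p + t *: v) = f p) ->
  forall p q, f p = f q.
Proof.
move=> fH.
have step p a b c : c = b * p 0 0 - a * p 0 1 -> f (p + mk3 a b c) = f p.
  by move=> cE; rewrite -[mk3 _ _ _]scale1r fH // /horizontal !mxE.
have radial p : f p = f (mk3 0 0 (p 0 2)).
  rewrite -(step p (- p 0 0) (- p 0 1) 0); last by ring.
  by congr f; apply: rV3P; rewrite !mxE /=; ring.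
(* A triangle of area s / 2 over the xy-plane lifts to a height gain of s. *)
have vert z s : f (mk3 0 0 (z + s)) = f (mk3 0 0 z).
  rewrite -(step (mk3 0 0 z) s 0 0); last by rewrite !mxE /=; ring.
  rewrite -(step (mk3 0 0 z + mk3 s 0 0) 0 1 s); last by rewrite !mxE /=; ring.
  by rewrite [RHS]radial; congr (f (mk3 0 0 _)); rewrite !mxE /=; ring.
move=> p q; rewrite [LHS]radial [RHS]radial.
by rewrite -(vert (p 0 2) (q 0 2 - p 0 2)) subrKC.
Qed.

Lemma deriv_eq0_horner (q : {poly R}) t : (forall s, q^`().[s] = 0) ->
  q.[t] = q.[0].
Proof.
move=> dq; have dq0 : q^`() = 0.
  by apply: contrapT => /eqP /poly_nonroot[s]; rewrite dq eqxx.
suff -> : q = (q`_0)%:P by rewrite !hornerC.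
apply/polyP => -[|i]; rewrite coefC //=.
have := coef_deriv q i; rewrite dq0 coef0 => /esym/eqP.
by rewrite mulrn_eq0 /= => /eqP.
Qed.

(** Ensures that a nonconstant [f] has a nonzero horizontal derivative on which to continue an
    induction. *)
Lemma wpoly_horizontal_const d f g h :
    (forall p v, exists q : {poly R}, [/\ (size q <= d)%N,
      forall t, q.[t] = f (p + t *: v) & horizontal p v -> forall t,
      q^`().[t] = v 0 0 * g (p + t *: v) + v 0 1 * h (p + t *: v)]) ->
    (forall p, g p = 0) -> (forall p, h p = 0) ->
  forall p q, f p = f q.
Proof.
move=> fq g0 h0; apply: horizontal_connected => p v t pv.
have [q [_ qE dq]] := fq p v.
rewrite -[in RHS](addr0 p) -(scale0r v) -!qE; apply: deriv_eq0_horner => s.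
by rewrite dq // g0 h0 !mulr0 addr0.
Qed.

End HorizontalConnectivity.

(** * Products and signs of a family along a line *)

Section Families.
Variable R : rcfType.
Implicit Types (fs : seq ('rV[R]_3 -> R)) (b v : 'rV[R]_3).

Lemma wfam_prod d fs : wfam d fs ->
  wpoly d (fun p => \prod_(f <- fs) f p) /\ exists p, \prod_(f <- fs) f p != 0.
Proof.
elim=> [|{}d e f {}fs p fP fp _ [fsP [p' fsp]]].
  split; last by exists 0; rewrite big_nil oner_neq0.
  apply: (@wpolyD _ _ 1 0 0 0 (fun=> 0)) => // [|p]; first exact: wpoly0.
  by rewrite big_nil /monomial3 !expr0 !mulr1 addr0.
split; first by apply: wpoly_ext (wpoly_mul fP fsP) => r; rewrite big_cons.
have [r fr] := wpoly_mul_neq0 fP fsP fp fsp.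
by exists r; rewrite big_cons.
Qed.

Lemma poly_no_root_sign (q : {poly R}) (s1 s2 : R) : s1 <= s2 ->
  (forall s, s1 <= s <= s2 -> q.[s] != 0) -> 0 < q.[s1] * q.[s2].
Proof.
move=> s12 nz; have nz1 := nz s1; have nz2 := nz s2.
rewrite !lexx s12 /= in nz1 nz2.
case: (ltrgt0P q.[s1]) (nz1 isT) (nz2 isT) => // q1 _;
  case: (ltrgt0P q.[s2]) => // q2 _.
- exact: mulr_gt0.
- have [|s sin] := @poly_ivt _ (- q) _ _ s12; last by rewrite rootN => /rootP q0;
    have := nz s sin; rewrite q0 eqxx.
  by rewrite !hornerN oppr_le0 oppr_ge0 !ltW.
- have [|s sin /rootP q0] := @poly_ivt _ q _ _ s12; first by rewrite !ltW.
  by have := nz s sin; rewrite q0 eqxx.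
by rewrite nmulr_rgt0.
Qed.

(** By the intermediate value theorem no factor changes sign between [s1] and [s2]. *)
Lemma wfam_same_sign d fs b v (s1 s2 : R) : wfam d fs -> s1 <= s2 ->
    (forall s, s1 <= s <= s2 -> \prod_(f <- fs) f (b + s *: v) != 0) ->
  same_sign fs (b + s1 *: v) (b + s2 *: v).
Proof.
move=> fsP s12; elim: fsP => // {}d e f {}fs p fP _ _ IH nz.
have [q _ qE] := wpoly_line b v fP.
rewrite /= IH ?andbT; last by move=> s /nz; rewrite big_cons mulf_eq0 => /norP[].
rewrite -!qE; apply: poly_no_root_sign => // s /nz.
by rewrite big_cons mulf_eq0 qE => /norP[].
Qed.

End Families.

(** * Counting incidences with Legendrian lines *)

Lemma card_relE (T U : finType) (r : T -> U -> bool) (L : {set U}) t :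
  #|[set u in L | r t u]| = (\sum_(u in L) r t u)%N.
Proof. by rewrite -sum1dep_card big_mkcondr; apply: eq_bigr => u _; case: (r t u). Qed.

Lemma double_counting (T U : finType) (r : T -> U -> bool)
    (P : {set T}) (L : {set U}) :
  (\sum_(t in P) #|[set u in L | r t u]|
     = \sum_(u in L) #|[set t in P | r t u]|)%N.
Proof.
under eq_bigr do rewrite card_relE; rewrite exchange_big /=.
by apply: eq_bigr => u _; rewrite (card_relE (fun u t => r t u)).
Qed.

Section LegendrianIncidences.
Variables (R : rcfType) (T U : finType) (pt : T -> 'rV[R]_3).
Variables (base dir : U -> 'rV[R]_3) (inc : T -> U -> bool).

Definition on_line (u : U) p := exists s : R, p = base u + s *: dir u.

Hypothesis pt_inj : injective pt.
Hypothesis incP : forall t u, inc t u <-> on_line u (pt t).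
Hypothesis dir_neq0 : forall u, dir u != 0.
Hypothesis dir_horizontal : forall u, horizontal (base u) (dir u).
Hypothesis line_inj : forall u u',
  (forall p, on_line u p <-> on_line u' p) -> u = u'.

Lemma dir_proportional u u' p c : dir u' = c *: dir u ->
  on_line u p -> on_line u' p -> u = u'.
Proof.
move=> du [s ps] [s' ps'].
have c0 : c != 0.
  by apply: contraNneq (dir_neq0 u') => c0; rewrite du c0 scale0r.
have bE : base u = base u' + (s' * c - s) *: dir u.
  apply: (addIr (s *: dir u)); rewrite -ps ps' du scalerA -addrA -scalerDl.
  by rewrite subrK.
apply: line_inj => r; split=> -[k ->].
  exists ((s' * c - s + k) / c); rewrite bE -addrA -scalerDl du scalerA.
  by rewrite divfK.
exists (k * c - (s' * c - s)); rewrite bE -addrA -scalerDl du scalerA.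
by congr (_ + _ *: _); ring.
Qed.

Lemma two_points_one_line t t' u u' : t != t' ->
  inc t u -> inc t' u -> inc t u' -> inc t' u' -> u = u'.
Proof.
move=> tt' /incP tu /incP t'u /incP tu' /incP t'u'.
case: (tu) (t'u) (tu') (t'u') => s1 e1 [s2 e2] [s3 e3] [s4 e4].
have d1 : pt t - pt t' = (s1 - s2) *: dir u.
  by rewrite e1 e2 opprD addrACA subrr add0r scalerBl.
have d2 : pt t - pt t' = (s3 - s4) *: dir u'.
  by rewrite e3 e4 opprD addrACA subrr add0r scalerBl.
have nz : s3 - s4 != 0.
  apply: contraNneq tt' => z; apply/eqP/pt_inj/eqP.
  by rewrite -subr_eq0 d2 z scale0r.
apply: (dir_proportional (c := (s1 - s2) / (s3 - s4))) tu tu'.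
by rewrite mulrC -scalerA -d1 d2 scalerA mulVf // scale1r.
Qed.

Lemma dir_horizontal_at u p : on_line u p -> horizontal p (dir u).
Proof.
by case=> s ->; have := dir_horizontal u; rewrite /horizontal !mxE => ->; ring.
Qed.

(* Two distinct Legendrian lines through [p] span the contact plane at [p]. *)
Lemma legendrian_independent u u' p (x y : R) : u != u' ->
    on_line u p -> on_line u' p ->
    dir u 0 0 * x + dir u 0 1 * y = 0 -> dir u' 0 0 * x + dir u' 0 1 * y = 0 ->
  x = 0 /\ y = 0.
Proof.
move=> uu' up u'p ex ey.
have hu := dir_horizontal_at up; have hu' := dir_horizontal_at u'p.
(* The determinant of the projections to the xy-plane. Horizontality fixes the third coordinates, so
   [D = 0] would make the directions proportional; otherwise Cramer's rule solves the system. *)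
pose D := dir u 0 0 * dir u' 0 1 - dir u 0 1 * dir u' 0 0.
have D0 : D != 0.
  apply: contraNneq uu' => D0; apply/eqP.
  have [a0|a0] := eqVneq (dir u 0 0) 0.
    have b0 : dir u 0 1 != 0.
      apply: contraNneq (dir_neq0 u) => b0; apply/eqP/rV3P; rewrite ?mxE //.
      by rewrite hu a0 b0; ring.
    have a'0 : dir u' 0 0 = 0.
      by apply/eqP; move: D0; rewrite /D a0 mul0r sub0r => /eqP;
        rewrite oppr_eq0 mulf_eq0 (negPf b0).
    apply: (dir_proportional (c := dir u' 0 1 / dir u 0 1)) up u'p.
    apply: rV3P; rewrite !mxE ?hu ?hu' ?a0 ?a'0; by field.
  apply: (dir_proportional (c := dir u' 0 0 / dir u 0 0)) up u'p.
  have b'E : dir u' 0 1 = dir u 0 1 * dir u' 0 0 / dir u 0 0.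
    by apply: (mulfI a0); move/eqP: D0; rewrite subr_eq0 => /eqP ->; field.
  by apply: rV3P; rewrite !mxE ?hu ?hu' ?b'E; field.
split; apply/eqP.
  have : D * x = 0.
    transitivity (dir u' 0 1 * (dir u 0 0 * x + dir u 0 1 * y)
      - dir u 0 1 * (dir u' 0 0 * x + dir u' 0 1 * y)); first by rewrite /D; ring.
    by rewrite ex ey !mulr0 subr0.
  by move/eqP; rewrite mulf_eq0 (negPf D0).
have : D * y = 0.
  transitivity (dir u 0 0 * (dir u' 0 0 * x + dir u' 0 1 * y)
    - dir u' 0 0 * (dir u 0 0 * x + dir u 0 1 * y)); first by rewrite /D; ring.
  by rewrite ex ey !mulr0 subr0.
by move/eqP; rewrite mulf_eq0 (negPf D0).
Qed.

Lemma line_parameter u :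
  {tau : T -> R & forall t, inc t u -> pt t = base u + tau t *: dir u}.
Proof.
apply: (@choice _ _ (fun t s => inc t u -> pt t = base u + s *: dir u)) => t.
by case: (boolP (inc t u)) => [/incP[s sP]|]; [exists s|exists 0].
Qed.

(** The parameters of the points are distinct roots of the nonzero restriction of [f] to the
    line. *)
Lemma points_of_roots d (E : {set T}) u f : wpoly d f ->
    (forall t, t \in E -> inc t u /\ f (pt t) = 0) ->
    (exists s, f (base u + s *: dir u) != 0) ->
  (#|E| <= d)%N.
Proof.
move=> fP Ef [s0 fs0]; have [q szq qE] := wpoly_line (base u) (dir u) fP.
have q0 : q != 0 by apply: contraNneq fs0 => q0; rewrite -qE q0 horner0.
have [rs szrs rsP] := poly_roots_seq q0.
have [tau tauP] := line_parameter u.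
have tau_inj : {in E &, injective tau}.
  move=> t t' /Ef[tu _] /Ef[t'u _] e; apply: pt_inj.
  by rewrite (tauP _ tu) (tauP _ t'u) e.
rewrite cardE -(size_map tau); apply: leq_trans (leq_trans (ltnW szrs) szq).
apply: uniq_leq_size.
  by rewrite map_inj_in_uniq ?enum_uniq // => t t'; rewrite !mem_enum; exact: tau_inj.
move=> s /mapP[t]; rewrite mem_enum => /Ef[tu ft] ->; apply: rsP.
by rewrite /root qE -tauP // ft.
Qed.

(** Points on at most one line cost |P \ P2|. A nonzero horizontal derivative [k] vanishes on [P2]:
    lines where [k] is not identically zero carry at most [d] points of [P2] each, and the other
    lines fall to the induction hypothesis for [k] and [P2]. *)
Lemma zero_set_incidences d f p0 : wpoly d f -> f p0 != 0 ->
    forall (P : {set T}) (L : {set U}),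
    (forall u, u \in L -> forall s, f (base u + s *: dir u) = 0) ->
  (\sum_(t in P) #|[set u in L | inc t u]| <= #|P| + d * #|L|)%N.
Proof.
elim: d f p0 => [|d IH] f p0 fP fp0 P L fL.
  by rewrite (wpoly_deg0 _ fP) eqxx in fp0.
have [g [h [gP hP fq]]] := wpoly_deriv fP.
pose P2 := [set t in P | (1 < #|[set u in L | inc t u]|)%N].
have gh0 t : t \in P2 -> g (pt t) = 0 /\ h (pt t) = 0.
  rewrite inE => /andP[_ /card_gt1P[u [u' [+ + uu']]]].
  rewrite !inE => /andP[uL tu] /andP[u'L tu'].
  have gh w : w \in L -> inc t w ->
      dir w 0 0 * g (pt t) + dir w 0 1 * h (pt t) = 0.
    move=> wL /incP[s ts]; have [q [_ qE dq]] := fq (base w) (dir w).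
    rewrite ts -dq; last exact: dir_horizontal.
    suff -> : q = 0 by rewrite deriv0 horner0.
    apply: contrapT => /eqP/poly_nonroot[r].
    by rewrite qE fL // eqxx.
  have [/incP pu /incP pu'] := (tu, tu').
  exact: legendrian_independent uu' pu pu' (gh u uL tu) (gh u' u'L tu').
have main k pk : wpoly d k -> k pk != 0 -> (forall t, t \in P2 -> k (pt t) = 0) ->
    (\sum_(t in P) #|[set u in L | inc t u]| <= #|P| + d.+1 * #|L|)%N.
  move=> kP kpk k0.
  pose L1 := [set u in L | `[< exists s, k (base u + s *: dir u) != 0 >]].
  have L1L : L1 \subset L by apply/subsetP => u; rewrite inE => /andP[].
  have P2P : P2 \subset P by apply/subsetP => t; rewrite inE => /andP[].
  have light : (\sum_(t in P :\: P2) #|[set u in L | inc t u]| <= #|P :\: P2|)%N.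
    rewrite -sum1_card; apply: leq_sum => t; rewrite 2!inE => /andP[+ tP].
    by rewrite tP -leqNgt.
  have out : (\sum_(t in P2) #|[set u in L1 | inc t u]| <= d * #|L1|)%N.
    rewrite double_counting mulnC -sum_nat_const; apply: leq_sum => u.
    rewrite inE => /andP[_ /asboolP ku]; apply: points_of_roots kP _ ku => t.
    by rewrite inE => /andP[/k0].
  have inn : (\sum_(t in P2) #|[set u in L :\: L1 | inc t u]|
                <= #|P2| + d * #|L :\: L1|)%N.
    apply: IH kP kpk _ _ _ => u; rewrite 2!inE => /andP[+ uL] s.
    by rewrite uL => /asboolP ku; apply: contrapT => /eqP ks; apply: ku; exists s.
  have -> : #|P| = (#|P2| + #|P :\: P2|)%N.
    by rewrite -(cardsID P2 P) (setIidPr P2P).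
  have -> : #|L| = (#|L1| + #|L :\: L1|)%N.
    by rewrite -(cardsID L1 L) (setIidPr L1L).
  rewrite (big_setID P2) /= (setIidPr P2P).
  have -> : (\sum_(t in P2) #|[set u in L | inc t u]|
      = \sum_(t in P2) #|[set u in L1 | inc t u]|
        + \sum_(t in P2) #|[set u in L :\: L1 | inc t u]|)%N.
    rewrite -big_split; apply: eq_bigr => t _ /=.
    by rewrite !card_relE (big_setID L1) /= (setIidPr L1L).
  by lia.
have [[p gp]|g0] := pselect (exists p, g p != 0).
  by apply: main gP gp _ => t /gh0[].
have [[p hp]|h0] := pselect (exists p, h p != 0).
  by apply: main hP hp _ => t /gh0[].
(* Both derivatives vanish identically, so [f] is constant; a line in [L] would force [f p0 = 0]. *)
have [L0|[u uL]] := set_0Vmem L.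
  by rewrite double_counting L0 big_set0.
have fC := wpoly_horizontal_const fq.
have : f p0 = f (base u + 0 *: dir u).
  by apply: fC => p; apply: contrapT => /eqP ?; [apply: g0|apply: h0]; exists p.
by move/eqP; rewrite fL // (negPf fp0).
Qed.

(** A class of k elements has k(k - 1) ordered collisions, and k is at most 1 + k(k - 1). *)
Lemma collision_count n (E : {set T}) (rho : T -> 'I_n) :
  (#|E| <= n + \sum_(t in E) #|[set t' in E | (t' != t) && (rho t' == rho t)]|)%N.
Proof.
have sumE (F : T -> nat) :
    (\sum_(t in E) F t = \sum_v \sum_(t in E | rho t == v) F t)%N.
  exact: (partition_big rho predT).
rewrite -sum1_card !sumE -[X in (_ <= X + _)%N]card_ord -sum1_card -big_split /=.
apply: leq_sum => v _; pose Ev := [set t in E | rho t == v].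
have inEv t : (t \in Ev) = (t \in E) && (rho t == v) by rewrite inE.
rewrite -!(eq_bigl _ _ inEv) sum1_card.
have -> : (\sum_(t in Ev) #|[set t' in E | (t' != t) && (rho t' == rho t)]|
           = #|Ev| * #|Ev|.-1)%N.
  rewrite -sum_nat_const; apply: eq_bigr => t tE.
  rewrite (cardsD1 t Ev) tE; congr #|pred_of_set _|; apply/setP => t'.
  move: tE; rewrite !inE => /andP[_ /eqP ->].
  by rewrite andbCA.
by case: #|Ev| => [|k] //=; nia.
Qed.

(** At most [d] points of the line are zeros of the product. The others are classified by the number
    [rho] of entries of [rs] below their parameter; equal values leave no root in between, so the
    points share a cell and [collision_count] applies. *)
Lemma cell_incidences u d fs : wfam d fs ->
    (exists s, \prod_(f <- fs) f (base u + s *: dir u) != 0) ->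
  (#|[set t | inc t u]| <= 2 * d + \sum_t #|[set t' in cell pt fs t |
      [&& t' != t, inc t u & inc t' u]]|)%N.
Proof.
move=> fsP nz; have [FP _] := wfam_prod fsP.
set F := fun p => \prod_(f <- fs) f p in FP.
have [tau tauP] := line_parameter u.
pose E := [set t | inc t u && (F (pt t) != 0)].
have [q szq qE] := wpoly_line (base u) (dir u) FP.
have q0 : q != 0.
  by case: nz => s; apply: contraNneq => q0; rewrite -/(F _) -qE q0 horner0.
have [rs szrs rsP] := poly_roots_seq q0.
pose below x := count (fun r => r < x) rs.
have ltd t : (below (tau t) < d)%N.
  by apply: leq_ltn_trans (count_size _ _) _; apply: leq_trans szrs szq.
pose rho t := Ordinal (ltd t).
have dead : (#|[set t | inc t u] :\: E| <= d)%N.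
  apply: points_of_roots FP _ nz => t; rewrite !inE.
  by case: (inc t u) => //=; rewrite ?andbF // andbT negbK => /eqP.
have same t t' : t \in E -> t' \in E -> rho t' = rho t -> t' \in cell pt fs t.
  move=> tE t'E /(congr1 val) /= e; rewrite inE.
  wlog le : t t' tE t'E e / tau t <= tau t'.
    move=> H; have [le|/ltW le] := leP (tau t) (tau t'); first exact: H.
    by rewrite same_sign_sym; apply: H.
  move: tE t'E; rewrite !inE => /andP[tu Ft] /andP[t'u Ft'].
  rewrite (tauP _ tu) (tauP _ t'u); apply: wfam_same_sign fsP le _ => s /andP[ls sl].
  rewrite -/(F _) -qE; apply/negP => qs.
  have srs : s \in rs by apply: rsP.
  have sl' : s < tau t'.
    rewrite lt_neqAle sl andbT; apply: contraNneq Ft' => se.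
    by rewrite (tauP _ t'u) -qE -se.
  (* A root [s] from [tau t] up to, but excluding, [tau t'] would make the count at [tau t']
     strictly larger. *)
  have : below (tau t') = (below (tau t)
      + count (fun r => (tau t <= r < tau t')%R) rs)%N.
    rewrite /below -count_predUI [X in (_ + X)%N](_ : _ = 0)%N ?addn0.
      apply: eq_count => r /=; have [rt|tr] := ltP r (tau t) => //=.
      by rewrite (lt_le_trans rt (le_trans ls sl)).
    apply/eqP; rewrite -leqn0 leqNgt -has_count; apply/hasPn => r _ /=.
    by rewrite leNgt; case: (r < tau t).
  rewrite e; apply/eqP; rewrite -[X in X == _]addn0 eqn_add2l eq_sym -lt0n -has_count.
  by apply/hasP; exists s => //=; rewrite ls.
have EA : E \subset [set t | inc t u].
  by apply/subsetP => t; rewrite !inE => /andP[].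
rewrite -(cardsID E) (setIidPr EA) mul2n -addnn -addnA addnC leq_add //.
apply: leq_trans (collision_count E rho) _; rewrite leq_add2l big_mkcond /=.
apply: leq_sum => t _; case: ifP => // tE; apply/subset_leq_card/subsetP => t'.
move=> /setIdP[t'E /andP[t't /eqP e]]; apply/setIdP; split; first exact: same.
rewrite t't /=.
by move: tE t'E; rewrite !inE => /andP[-> _] /andP[-> _].
Qed.

(** Scaling by [8 ^ K] keeps the bound in the natural numbers; [768 = 2 * 384] joins the factor 2 of
    [cell_incidences] to the degree bound. *)
Lemma incidence_bound K :
  (8 ^ K * \sum_t #|[set u | inc t u]|
     <= 8 ^ K * (#|T| + 768 * 2 ^ K * #|U|) + #|T| ^ 2)%N.
Proof.
have [d [fs [dK fsP fsK]]] := polynomial_partition pt K.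
have [FP [p0 Fp0]] := wfam_prod fsP.
pose L0 := [set u | `[< forall s, \prod_(f <- fs) f (base u + s *: dir u) = 0 >]].
have in0 : (\sum_(t in [set: T]) #|[set u in L0 | inc t u]| <= #|T| + d * #|L0|)%N.
  rewrite -cardsT; apply: zero_set_incidences FP Fp0 _ _ _ => u.
  by rewrite inE => /asboolP.
have out0 : (\sum_(u in ~: L0) #|[set t | inc t u]|
    <= 2 * d * #|~: L0| + \sum_t #|cell pt fs t|)%N.
  rewrite mulnC -sum_nat_const.
  apply: (@leq_trans (\sum_(u in ~: L0) (2 * d + \sum_t #|[set t' in cell pt fs t |
      [&& t' != t, inc t u & inc t' u]]|))%N).
    apply: leq_sum => u; rewrite 2!inE => /asboolP/existsNP[s /eqP nz].
    by apply: cell_incidences fsP _; exists s.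
  rewrite big_split leq_add2l /= exchange_big; apply: leq_sum => t _ /=.
  (* An ordered pair of distinct points in a cell is charged to at most one line. *)
  rewrite -(double_counting (fun t' u => [&& t' != t, inc t u & inc t' u])).
  rewrite -sum1_card; apply: leq_sum => t' _.
  apply/card_le1_eqP => u u'; rewrite !inE.
  move=> /andP[_ /and3P[tt' tu t'u]] /andP[_ /and3P[_ tu' t'u']].
  exact: two_points_one_line tt' t'u' tu' t'u tu.
have cells : (8 ^ K * \sum_t #|cell pt fs t| <= #|T| ^ 2)%N.
  rewrite big_distrr /= -mulnn -sum_nat_const.
  by apply: leq_sum => t _; exact: fsK.
have -> : (\sum_t #|[set u | inc t u]| =
    \sum_(t in [set: T]) #|[set u in L0 | inc t u]|
      + \sum_(u in ~: L0) #|[set t | inc t u]|)%N.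
  have -> : (\sum_(u in ~: L0) #|[set t | inc t u]|
      = \sum_(t in [set: T]) #|[set u in ~: L0 | inc t u]|)%N.
    rewrite double_counting; apply: eq_bigr => u _.
    by apply: eq_card => t; rewrite !inE.
  rewrite -big_split /= [RHS]big_mkcond; apply: eq_bigr => t _; rewrite inE.
  rewrite -(cardsID L0); congr (_ + _)%N; apply: eq_card => u; rewrite !inE andbC //.
have := cardsC L0; set a := #|L0|; set b := #|~: L0| => <-.
apply: (@leq_trans (8 ^ K * (#|T| + 2 * d * (a + b)) + 8 ^ K * \sum_t #|cell pt fs t|)%N).
  rewrite -mulnDr leq_mul2l; apply/orP; right.
  by apply: leq_trans (leq_add in0 out0) _; lia.
rewrite leq_add // leq_mul2l leq_add2l leq_mul2r (_ : 768 = 2 * 384)%N // -mulnA.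
by rewrite leq_mul2l dK !orbT.
Qed.

End LegendrianIncidences.

(* Choice of the degree and transfer to finite sets *)
From mathcomp Require Import finmap.
From mathcomp Require Import all_classical all_reals all_analysis.
Local Open Scope classical_set_scope.
Local Open Scope ring_scope.

Lemma optimize_degree (R : realType) (N p l : nat) :
    (forall K, 8 ^ K * N <= 8 ^ K * (p + 768 * 2 ^ K * l) + p ^ 2)%N ->
  N%:R <= 776 * (p%:R `^ (1 / 2) * l%:R `^ (3 / 4) + p%:R + l%:R) :> R.
Proof.
move=> bound; set X := _ `^ _ * _; have X0 : 0 <= X by rewrite mulr_ge0 ?powR_ge0.
have p0 : 0 <= p%:R :> R by []; have l0 : 0 <= l%:R :> R by [].
have X4 : X ^+ 4 = (p ^ 2 * l ^ 3)%:R.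
  rewrite /X exprMn -!powR_mulrn ?powR_ge0 // -!powRrM natrM !natrX.
  by rewrite -!powR_mulrn //; congr (_ `^ _ * _ `^ _); lra.
(* For [p ^ 2 <= l] the choice [K = 0] suffices, as [l] absorbs the quadratic term. *)
have [pl|lp] := leqP (p ^ 2) l.
  have : N%:R <= p%:R + 768 * l%:R + l%:R :> R.
    have := bound 0%N; rewrite !expn0 !mul1n muln1 => b.
    by rewrite -natrM -!natrD ler_nat (leq_trans b) // leq_add2l.
  lra.
(* Without lines, [K = p ^ 2] makes [8 ^ K] exceed the error [p ^ 2], which then cannot pay for one
   extra incidence. *)
have [l_eq0|l_gt0] := posnP l.
  have : (N <= p)%N.
    have [x px b] : exists2 x, (p ^ 2 < x)%N & (x * N <= x * p + p ^ 2)%N.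
      exists (8 ^ (p ^ 2))%N; first exact: ltn_expl.
      by have := bound (p ^ 2)%N; rewrite l_eq0 muln0 addn0.
    rewrite leqNgt; apply/negP => pN.
    by have := leq_mul (leqnn x) pN; rewrite mulnS; lia.
  by rewrite -(ler_nat R); lra.
have n_gt0 : (0 < p ^ 2 %/ l)%N by rewrite divn_gt0 // ltnW.
(* Now [16 ^ K] is p^2 / l up to a factor 16, so [2 ^ K] has order p^(1/2) / l^(1/4). The
   comparisons with [X] are made on fourth powers. *)
pose K := trunc_log 16 (p ^ 2 %/ l).
have /andP[lo hi] := trunc_log_bounds (isT : 1 < 16)%N n_gt0.
rewrite -/K leq_divRL // in lo; rewrite -/K ltn_divLR // in hi.
have pow16 k : (16 ^ k = (2 ^ k) ^ 4)%N by rewrite -expnM mulnC expnM.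
have pow8 k : (8 ^ k = (2 ^ k) ^ 3)%N by rewrite -expnM mulnC expnM.
have small : (2 ^ K * l)%:R <= X.
  rewrite -(ler_pXn2r (isT : 0 < 4)%N) ?nnegrE // X4 -natrX ler_nat.
  rewrite expnMn -pow16 (expnS l 3) mulnA.
  by rewrite leq_mul2r lo orbT.
have large : (p ^ 2)%:R <= 8%:R * (8 ^ K)%:R * X.
  rewrite -(ler_pXn2r (isT : 0 < 4)%N) ?nnegrE ?mulr_ge0 // exprMn X4.
  rewrite -natrM -!natrX -natrM ler_nat -expnS pow8.
  have -> : (((2 ^ K.+1) ^ 3) ^ 4 * (p ^ 2 * l ^ 3) = p ^ 2 * (16 ^ K.+1 * l) ^ 3)%N.
    by rewrite pow16; ring.
  by rewrite (expnS (p ^ 2) 3) leq_mul2l leq_exp2r // ltnW ?orbT.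
have : (8 ^ K)%:R * N%:R <= (8 ^ K)%:R * (p%:R + 768 * (2 ^ K * l)%:R)
                            + (p ^ 2)%:R :> R.
  by rewrite -!natrM -!natrD -natrM -natrD ler_nat mulnA.
have e0 : 0 < (8 ^ K)%:R :> R by rewrite ltr0n expn_gt0.
(* The constant is 776 = 768 + 8, from [small] and [large]. *)
move=> b; have {}b : (8 ^ K)%:R * N%:R <= (8 ^ K)%:R * (p%:R + 776 * X).
  apply: le_trans b _; move: small large e0; move: (8 ^ K)%:R => e.
  move: (2 ^ K * l)%:R (p ^ 2)%:R => a c; nra.
by move: b; rewrite ler_pM2l //; lra.
Qed.

Lemma incidences_sum (R : realType) (P : {fset 'rV[R]_3})
    (L : {fset (set 'rV[R]_3)}) :
  (incidences P L <= \sum_(t : P) #|[set u : L | `[< val u (val t) >] ]%SET|)%N.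
Proof.
pose A := [set x : P * L | `[< val x.2 (val x.1) >] ]%SET.
have sub : ([fset pl in (P `*` L)%fset | `[< pl.2 pl.1 >] ]
            `<=` [fset (val x.1, val x.2) | x in enum A])%fset.
  apply/fsubsetP => -[p l]; rewrite !inE /= => /andP[/andP[pP lL] pl].
  apply/imfsetP; exists ([`pP]%fset, [`lL]%fset) => //=.
  by rewrite mem_enum inE.
apply: leq_trans (fsubset_leq_card sub) _.
apply: leq_trans (leq_imfset_card _ _ _) _.
apply: (@leq_trans (size (enum A))).
  by apply: uniq_leq_size (enum_finmem_uniq _) _ => x; rewrite enum_finmemE.
rewrite -cardE -sum1_card.
under [leqRHS]eq_bigr do rewrite -sum1_card.
rewrite pair_big_dep /=.
by apply/eq_leq/eq_bigl => -[t u]; rewrite !inE.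
Qed.

Theorem theorem3p3 (R : realType) :
  exists C : R,
    forall (P : {fset 'rV[R]_3}) (L : {fset (set 'rV[R]_3)}),
      (forall l : set 'rV[R]_3, l \in L -> legendrian_line l /\ ~ vertical l) ->
      (incidences P L)%:R <=
        C * (#|` P|%:R `^ (1 / 2) * #|` L|%:R `^ (3 / 4)
             + #|` P|%:R + #|` L|%:R).
Proof.
exists 776 => P L LP; apply: optimize_degree => K.
have [par parP] : {par : L -> 'rV[R]_3 * 'rV[R]_3 & forall u,
    [/\ (par u).2 != 0, val u = line_through (par u).1 (par u).2 &
        horizontal (par u).1 (par u).2]}.
  apply: (@choice _ _ (fun (u : L) (par : 'rV[R]_3 * 'rV[R]_3) => [/\ par.2 != 0,
    val u = line_through par.1 par.2 & horizontal par.1 par.2])) => u.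
  have [[[v uv] leg] _] := LP _ (valP u).
  have [v0 [a ua]] := uv; exists (a, v); split=> //=.
  have : val u a by rewrite ua; exists 0 => //; rewrite scale0r addr0.
  (* Orthogonality to the contact normal at the base point [a], written out in coordinates, is
     [horizontal a v]. *)
  move=> /(leg v a uv); rewrite /orthogonal3 /horizontal !big_ord_recl big_ord0.
  rewrite !mxE /= (_ : lift ord0 ord0 = 1); last exact: val_inj.
  rewrite (_ : lift ord0 (lift ord0 ord0) = 2); last exact: val_inj.
  by lra.
pose base u := (par u).1; pose dir u := (par u).2.
pose inc (t : P) (u : L) := `[< val u (val t) >].
have onE u p : on_line base dir u p <-> val u p.
  have [_ -> _] := parP u; split=> [[s ->]|[s _ <-]]; last by exists s.
  by exists s.
have incP t u : inc t u <-> on_line base dir u (val t).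
  by rewrite onE; split=> [/asboolP|/asboolP].
apply: leq_trans (_ : _ <= 8 ^ K * \sum_t #|[set u | inc t u]%SET|)%N _.
  by rewrite leq_mul2l incidences_sum orbT.
have := @incidence_bound R P L val base dir inc val_inj incP _ _ _ K.
rewrite -!cardfE; apply.
- by move=> u; case: (parP u).
- by move=> u; case: (parP u).
move=> u u' uu'; apply: val_inj; apply/seteqP; split=> p.
  by move=> /onE/uu'/onE.
by move=> /onE/uu'/onE.
Qed.
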